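(* Let $\lambda,\mu\in[0,1]$ with $\mu\le\lambda$, let $\sigma(x,x_*,T,T_* )=0$ (no interaction noise), and let $f=f(x,T,t)$ be a solution of the kinetic equation $\partial_t f=\mathcal L(f)+Q(f,f)$ defined in the context. Then the second temperature moment $M_2(t)=\int_\Omega f(x,T,t)\,T^2\,d\omega$ satisfies $$\frac{dM_2}{dt}=\int_{\Omega\times\Omega}\left[(\mu-\lambda)(T^2-T_*^2)+(\lambda^2+\mu^2-\lambda-\mu)(T-T_* )^2\right]\chi_{\mathcal F}(x,x_*,T,T_* )\,f f_*\,d\omega\,d\omega_*,$$ where $f=f(x,T,t)$ and $f_*=f(x_*,T_*,t)$.
   Context: $\mathcal D\subseteq\mathbb R^d$, $d\geq 1$; $\mathcal F:\mathcal D\to\mathbb R$ is continuous; $\Omega=\mathcal D\times\mathbb R^+$, $\omega=(x,T)$, $d\omega=dx\,dT$ (similarly $\omega_*=(x_*,T_* )$); $f(\cdot,\cdot,t)$ is a probability density on $\Omega$. Interaction indicator: $\chi_{\mathcal F}(x,x_*,T,T_* )=\Psi(\mathcal F(x)<\mathcal F(x_* ))\,\Psi(T_*<T)$, with $\Psi(\cdot)$ equal to $1$ if its argument is true and $0$ otherwise. Binary temperature interaction between $(x,T)$ and $(x_*,T_* )$, with noise intensity $\sigma$ and symmetric mean-zero random variables $\zeta,\zeta_*$: $$T'=T-\lambda(T-T_* )\chi_{\mathcal F}(x,x_*,T,T_* )-\mu(T-T_* )\chi_{\mathcal F}(x_*,x,T_*,T)+\sigma(x,x_*,T,T_* )\zeta,$$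 $$T_*'=T_*-\lambda(T_*-T)\chi_{\mathcal F}(x_*,x,T_*,T)-\mu(T_*-T)\chi_{\mathcal F}(x,x_*,T,T_* )+\sigma(x_*,x,T_*,T)\zeta_*.$$ The interaction operator $Q$ is defined in weak form, with $\mathbb E$ the expectation over $\zeta,\zeta_*$ (trivial when $\sigma=0$), by $$\int_\Omega Q(f,f)\varphi\,d\omega=\mathbb E\left[\int_{\Omega\times\Omega}\big(\varphi(x,T')-\varphi(x,T)\big)f f_*\,d\omega\,d\omega_*\right].$$ The exploration operator $\mathcal L$ is defined in weak form by $$\int_\Omega\mathcal L(f)\varphi\,d\omega=\mathbb E\left[\int_\Omega\mathcal B_{\mathcal F}(x\to x',T)\big(\varphi(x',T)-\varphi(x,T)\big)f(x,T,t)\,d\omega\right],$$ where $x'=x+\eta(T)\xi$ with $\eta$ a given function, $\mathbb E$ is here the expectation over $\xi$ with symmetric density $p(\xi,T)$ on $\mathbb R^d$, $\mathcal B_{\mathcal F}(x\to x',T)=\min\{1,e^{-(\mathcal F(x')-\mathcal F(x))/T}\}$, and moves with $x'\notin\mathcal D$ are rejected (contribute zero). A solution $f$ satisfies $\frac{d}{dt}\int_\Omega f\varphi\,d\omega=\int_\Omega\mathcal L(f)\varphi\,d\omega+\int_\Omega Q(f,f)\varphi\,d\omega$ for test functions $\varphi$; it is assumed regular and integrable enough that $\varphi(x,T)=T^2$ is an admissible test function, with all integrals involved absolutely convergent. *)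

(* Defs.v *)
From HB Require Import structures.
From mathcomp Require Import all_boot all_order all_algebra.
From mathcomp Require Import all_classical all_reals all_analysis.
Set Implicit Arguments.
Unset Strict Implicit.
Unset Printing Implicit Defensive.
Import Order.TTheory GRing.Theory Num.Theory.
Import numFieldNormedType.Exports.
Local Open Scope classical_set_scope.
Local Open Scope ring_scope.

(* Product sigma-algebra on R^n, generated by the coordinate projections as for
   n.-tuple in the library; for R^n it coincides with the Borel sets. *)
Section measurable_rV.
Context {R : realType} {n : nat}.

Let coords : 'I_n -> 'rV[R]_n -> measurableTypeR R := fun i x => x ord0 i.

Let rV_set0 : g_sigma_preimage coords set0.
Proof. exact: sigma_algebra0. Qed.

Let rV_setC A : g_sigma_preimage coords A -> g_sigma_preimage coords (~` A).
Proof. exact: sigma_algebraC. Qed.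

Let rV_bigcup (F : (set _)^nat) : (forall i, g_sigma_preimage coords (F i)) ->
  g_sigma_preimage coords (\bigcup_i (F i)).
Proof. exact: sigma_algebra_bigcup. Qed.

HB.instance Definition _ := @isMeasurable.Build default_measure_display
  'rV[R]_n (g_sigma_preimage coords) rV_set0 rV_setC rV_bigcup.

Lemma measurable_coord (i : 'I_n) :
  measurable_fun [set: 'rV[R]_n] (fun x : 'rV[R]_n => x ord0 i : measurableTypeR R).
Proof.
move=> _ Y mY; rewrite setTI; apply: sub_sigma_algebra.
rewrite -bigcup_seq/=; exists i => /=; first by rewrite mem_index_enum.
by exists Y => //; rewrite setTI.
Qed.

End measurable_rV.

Lemma measurable_rVP d (T : measurableType d) (R : realType) n
    (f : T -> 'rV[R]_n) :
  (forall i, measurable_fun [set: T] (fun t => f t ord0 i)) ->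
  measurable_fun [set: T] f.
Proof.
move=> mf; apply: (@measurability _ _ _ _ _ _
  (\big[setU/set0]_(i < n)
     preimage_set_system setT (fun x : 'rV[R]_n => x ord0 i) measurable)) => //.
move=> _ [A bA <-]; move: bA; rewrite -bigcup_seq => -[i /= _ [B mB <-]].
by rewrite !setTI; have := mf i measurableT B mB; rewrite setTI.
Qed.

(* Same function as \x, whose canonical instances in the library stop at
   measures when the factors are only sigma-finite. *)
Section sigma_prod.
Context d1 d2 (T1 : measurableType d1) (T2 : measurableType d2) (R : realType).
Variable m1 : {sigma_finite_measure set T1 -> \bar R}.
Variable m2 : {sigma_finite_measure set T2 -> \bar R}.

Definition sigma_prod : set (T1 * T2) -> \bar R := (m1 \x m2)%E.

HB.instance Definition _ := Measure.on sigma_prod.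

Let sigma_prodT : sigma_finite setT sigma_prod.
Proof.
have /sigma_finiteP[F [TF ndF Foo]] := sigma_finiteT m1.
have /sigma_finiteP[G [TG ndG Goo]] := sigma_finiteT m2.
exists (fun n => F n `*` G n).
  rewrite -setXTT TF TG predeqE => -[x y]; split.
    move=> [/= [n _ Fnx] [k _ Gky]]; exists (maxn n k) => //; split.
    - by move: x Fnx; exact/subsetPset/ndF/leq_maxl.
    - by move: y Gky; exact/subsetPset/ndG/leq_maxr.
  by move=> [n _ []/= ? ?]; split; exists n.
move=> k; have [? ?] := Foo k; have [? ?] := Goo k.
split; first exact: measurableX.
by rewrite /sigma_prod product_measure1E// lte_mul_pinfty// ge0_fin_numE.
Qed.

HB.instance Definition _ := Measure_isSigmaFinite.Build _ _ _ sigma_prod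
  sigma_prodT.

End sigma_prod.

Section lebesgue_rV.
Context {R : realType}.

Definition rV_cons n (p : measurableTypeR R * 'rV[R]_n) : 'rV[R]_n.+1 :=
  row_mx (const_mx p.1 : 'rV_1) p.2.

Lemma rV_cons0 n (p : measurableTypeR R * 'rV[R]_n) : rV_cons p ord0 ord0 = p.1.
Proof.
transitivity (rV_cons p ord0 (lshift n (ord0 : 'I_1))).
  by congr (rV_cons p _ _); exact: val_inj.
by apply: etrans (row_mxEl _ _ _ _) _; rewrite mxE.
Qed.

Lemma rV_consS n (p : measurableTypeR R * 'rV[R]_n) i : rV_cons p ord0 (lift ord0 i) = p.2 ord0 i.
Proof.
transitivity (rV_cons p ord0 (rshift 1 i)).
  by congr (rV_cons p _ _); exact: val_inj.
exact: row_mxEr.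
Qed.

Lemma measurable_rV_cons n : measurable_fun [set: measurableTypeR R * 'rV[R]_n] (@rV_cons n).
Proof.
apply: measurable_rVP => i; case: (unliftP ord0 i) => [j ->|->].
- under eq_fun do rewrite rV_consS.
  exact: measurableT_comp (measurable_coord j) measurable_snd.
- under eq_fun do rewrite rV_cons0.
  exact: measurable_fst.
Qed.

Definition rV_uncons n (x : 'rV[R]_n.+1) : measurableTypeR R * 'rV[R]_n :=
  (x ord0 ord0, \row_j x ord0 (lift ord0 j)).

Lemma rV_consK n : cancel (@rV_cons n) (@rV_uncons n).
Proof.
move=> [a x]; congr pair; rewrite ?rV_cons0//.
by apply/rowP => j; rewrite mxE rV_consS.
Qed.

Lemma measurable_rV_uncons n :
  measurable_fun [set: 'rV[R]_n.+1] (@rV_uncons n).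
Proof.
apply: measurable_fun_pair; first exact: measurable_coord.
apply: measurable_rVP => j; under eq_fun do rewrite mxE.
exact: measurable_coord.
Qed.

HB.instance Definition _ n :=
  isMeasurableFun.Build _ _ _ _ (@rV_cons n) (@measurable_rV_cons n).

Lemma sigma_finite_rV_cons n
    (mu : {sigma_finite_measure set (measurableTypeR R * 'rV[R]_n)%type -> \bar R}) :
  sigma_finite [set: 'rV[R]_n.+1] (pushforward mu (@rV_cons n)).
Proof.
have [F TF Foo] := sigma_finiteT mu.
exists (fun k => @rV_uncons n @^-1` F k).
  by rewrite -preimage_bigcup -TF preimage_setT.
move=> k; have [mF Fk] := Foo k; split.
  by rewrite -[X in measurable X]setTI; exact: measurable_rV_uncons.
rewrite /pushforward -comp_preimage (_ : _ \o _ = id) ?preimage_id//.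
by apply/funext => x /=; rewrite rV_consK.
Qed.

Section step.
Variables (n : nat) (mu : {sigma_finite_measure set 'rV[R]_n -> \bar R}).
Let nu0 : {sigma_finite_measure set (measurableTypeR R * 'rV[R]_n)%type -> \bar R} :=
  sigma_prod (@lebesgue_measure R) mu.
Let nu := pushforward nu0 (@rV_cons n).
HB.instance Definition _ :=
  Measure.copy nu (measure_function_pushforward__canonical__measure_function_Measure
    nu0 (@measurable_rV_cons n)).
HB.instance Definition _ := Measure_isSigmaFinite.Build _ _ _ nu
  (sigma_finite_rV_cons nu0).
Definition lebesgue_rV_step : {sigma_finite_measure set 'rV[R]_n.+1 -> \bar R} := nu.
End step.

(* Lebesgue measure on R^n; see lebesgue_rV_box *)
Fixpoint lebesgue_rV n : {sigma_finite_measure set 'rV[R]_n -> \bar R} :=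
  if n is n'.+1 then lebesgue_rV_step (lebesgue_rV n') else \d_ (0 : 'rV[R]_0).

Lemma lebesgue_rV_box n (A : 'I_n -> set (measurableTypeR R)) :
  (forall i, measurable (A i)) ->
  lebesgue_rV n [set x | forall i, A i (x ord0 i)] =
  (\prod_(i < n) lebesgue_measure (A i))%E.
Proof.
elim: n A => [|n IHn] A mA.
  rewrite big_ord0 /= diracE mem_set//.
  by move=> [].
pose B : set 'rV[R]_n := [set x | forall i, A (lift ord0 i) (x ord0 i)].
have mB : measurable B.
  rewrite (_ : B = \bigcap_(i in [set: 'I_n])
      ((fun x : 'rV[R]_n => x ord0 i) @^-1` A (lift ord0 i))).
    apply: fin_bigcap_measurable => // i _.
    rewrite -[X in measurable X]setTI.
    exact: measurable_coord.
  by apply/seteqP; split => x xA i; [move=> _; exact: xA|exact: (xA i I)].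
rewrite big_ord_recl -(IHn (fun i => A (lift ord0 i)))//.
rewrite -/B -product_measure1E//.
rewrite /= /lebesgue_rV_step /= /pushforward /sigma_prod; congr product_measure1.
apply/seteqP; split => [[a x]|[a x]] /=.
  move=> ax; split; first by have := ax ord0; rewrite rV_cons0.
  by move=> i; have := ax (lift ord0 i); rewrite rV_consS.
move=> -[Aa Ax] i; case: (unliftP ord0 i) => [j ->|->].
  by rewrite rV_consS; exact: Ax.
by rewrite rV_cons0.
Qed.

End lebesgue_rV.

Section kinetic_model.
Context {R : realType} {d : nat}.
Notation space := 'rV[R]_d.
(* measurableTypeR R is R; lebesgue_measure lives on this copy *)
Notation state := (space * measurableTypeR R)%type.
Implicit Types (D : set space) (F : space -> R) (f : space -> R -> R -> R)
  (phi g : space -> R -> R).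

Definition Omega D : set state := [set w | D w.1 /\ (0 : R) < w.2].

Definition vol : {sigma_finite_measure set state -> \bar R} :=
  sigma_prod (@lebesgue_rV R d) (@lebesgue_measure R).

Definition vol2 : {sigma_finite_measure set (state * state)%type -> \bar R} :=
  sigma_prod vol vol.

Definition probability_density D g : Prop :=
  [/\ measurable_fun (Omega D) (fun w : state => g w.1 w.2 : R),
      forall w, Omega D w -> 0 <= g w.1 w.2 &
      (\int[vol]_(w in Omega D) (g w.1 w.2)%:E = 1)%E].

Definition chi F (x xs : space) (T Ts : R) : R :=
  (F x < F xs)%R%:R * (Ts < T)%R%:R.

(* the pair (T', T_*'), with z, zs the values of the two noises *)
Definition interaction F (lambda mu : R) (sigma : space -> space -> R -> R -> R)
    (x xs : space) (T Ts z zs : R) : R * R :=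
  (T - lambda * (T - Ts) * chi F x xs T Ts - mu * (T - Ts) * chi F xs x Ts T
     + sigma x xs T Ts * z,
   Ts - lambda * (Ts - T) * chi F xs x Ts T - mu * (Ts - T) * chi F x xs T Ts
     + sigma xs x Ts T * zs).

Definition metropolis F (x x' : space) (T : R) : R :=
  Num.min 1 (expR (- (F x' - F x) / T)).

Definition symmetric_density (p : space -> R -> R) : Prop :=
  forall T : R, 0 < T ->
  [/\ measurable_fun [set: space] (p ^~ T : space -> R),
      forall xi, 0 <= p xi T,
      forall xi, p (- xi) T = p xi T &
      (\int[lebesgue_rV d]_xi (p xi T)%:E = 1)%E].

Definition symmetric_centered dW (W : measurableType dW) (P : probability W R)
    (Z : {RV P >-> R}) : Prop :=
  [/\ P.-integrable setT (EFin \o Z),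
      ('E_P[Z] = 0)%E &
      forall A : set R, measurable A ->
        P [set a | A (Z a)] = P [set a | A (- Z a)]].

Section weak_form.
Variables (D : set space) (F : space -> R).
Variables (lambda mu : R) (sigma : space -> space -> R -> R -> R).
Context {dW : measure_display} {W : measurableType dW} (P : probability W R).
Variables (zeta zetas : {RV P >-> R}).
Variables (eta : R -> R) (p : space -> R -> R).

Definition Q_integrand f t phi (a : W) (w ws : state) : R :=
  (phi w.1 (interaction F lambda mu sigma w.1 ws.1 w.2 ws.2
              (zeta a) (zetas a)).1 - phi w.1 w.2)
  * f w.1 w.2 t * f ws.1 ws.2 t.

Definition weak_Q f t phi : R :=
  fine 'E_P[fun a => \int[vol2]_(q in Omega D `*` Omega D)
                       Q_integrand f t phi a q.1 q.2].

(* the expectation over the law p(., T) of xi is written as an integral against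
   p, and the indicator of D at x' rejects the moves leaving D *)
Definition L_integrand f t phi (w : state) (xi : space) : R :=
  let x' := w.1 + eta w.2 *: xi in
  p xi w.2 * (\1_D x' * metropolis F w.1 x' w.2 * (phi x' w.2 - phi w.1 w.2)
              * f w.1 w.2 t).

Definition weak_L f t phi : R :=
  \int[vol]_(w in Omega D) \int[lebesgue_rV d]_xi L_integrand f t phi w xi.

Definition moment f phi t : R :=
  \int[vol]_(w in Omega D) (f w.1 w.2 t * phi w.1 w.2).

Definition absolutely_convergent f t phi : Prop :=
  [/\ vol.-integrable (Omega D)
        (fun w => (f w.1 w.2 t * phi w.1 w.2)%:E),
      (vol \x lebesgue_rV d)%E.-integrable (Omega D `*` setT)
        (fun q => (L_integrand f t phi q.1 q.2)%:E) &
      (P \x vol2)%E.-integrable (setT `*` (Omega D `*` Omega D))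
        (fun q => (Q_integrand f t phi q.1 q.2.1 q.2.2)%:E)].

(* weak solution on positive times, tested against the functions in Phi *)
Definition kinetic_solution (Phi : set (space -> R -> R)) f : Prop :=
  forall t : R, 0 < t ->
    probability_density D (fun x T => f x T t) /\
    forall phi, Phi phi ->
      absolutely_convergent f t phi /\
      is_derive t 1 (moment f phi) (weak_L f t phi + weak_Q f t phi).

End weak_form.
End kinetic_model.

(* Main.v *)
Require Import Defs.
From HB Require Import structures.
From mathcomp Require Import all_boot all_order all_algebra.
From mathcomp Require Import all_classical all_reals all_analysis.
From mathcomp Require Import measurable_realfun ring.
Set Implicit Arguments.
Unset Strict Implicit.
Unset Printing Implicit Defensive.
Import Order.TTheory GRing.Theory Num.Theory.
Import numFieldNormedType.Exports.
Local Open Scope classical_set_scope.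
Local Open Scope ring_scope.

(** The exploration moves leave the temperature unchanged, so that a test
function of the temperature alone makes the integrand of [weak_L] vanish
([weak_L_temperature]) and only the interaction operator moves the second
moment.

In one collision [chi F x xs T Ts] and [chi F xs x Ts T] are never both nonzero,
since each one requires its first particle to be strictly hotter than the other.
So [post_hot] and [post_cold] give the new temperature of the first particle:
the hotter partner only feels the rate [lambda], the colder one the rate [mu],
and a pair at equal temperatures does not interact. The integrand of
[weak_Q] describes only the first particle of an ordered pair; as the two
particles are distributed alike, the ordered pairs in which that particle is the
colder one can be relabelled ([Rintegral_fold]), which turns the integral over
all pairs into one over the pairs whose first particle is the hotter, the
integrand now being the balance of both particles. That balance is the stated
expression ([post_sqr_balance]).

Cutting the domain along [Ts < T] keeps both pieces integrable, because this set
is measurable and the whole integrand is integrable. Integrability is given over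
the noise space times the pairs; without noise the integrand does not depend on
the noise variable, which can then be integrated out ([integrable_indep]). *)

Section swap.
Context d (T : measurableType d) (R : realType).
Variable m : {sigma_finite_measure set T -> \bar R}.
Implicit Types (C : set T) (E : set (T * T)).
Local Open Scope ereal_scope.

Lemma measurable_swapT d1 d2 (T1 : measurableType d1) (T2 : measurableType d2) :
  measurable_fun [set: T1 * T2] (fun z => (z.2, z.1)).
Proof.
by apply: measurable_fun_pair; [exact: measurable_snd|exact: measurable_fst].
Qed.

Lemma ge0_integral_swap (g : T * T -> \bar R) :
  measurable_fun setT g -> (forall z, 0 <= g z) ->
  \int[sigma_prod m m]_z g (z.2, z.1) = \int[sigma_prod m m]_z g z.
Proof.
move=> mg g0; rewrite [RHS]fubini_tonelli2//.
rewrite (@fubini_tonelli1 _ _ _ _ _ m m (fun z => g (z.2, z.1)))//.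
apply: (measurableT_comp mg); exact: measurable_swapT.
Qed.

(** The positive and negative parts are exchanged separately, so the two sides
agree even when they are differences of infinite terms. *)
Lemma integral_swap (g : T * T -> \bar R) : measurable_fun setT g ->
  \int[sigma_prod m m]_z g (z.2, z.1) = \int[sigma_prod m m]_z g z.
Proof.
move=> mg; rewrite integralE [RHS]integralE.
rewrite -(ge0_integral_swap (measurable_funepos mg))//.
rewrite -(ge0_integral_swap (measurable_funeneg mg))//.
by congr (_ - _); apply: eq_integral => z _; rewrite ?funeposE ?funenegE.
Qed.

Lemma integrable_swap (g : T * T -> \bar R) :
  (sigma_prod m m).-integrable setT g ->
  (sigma_prod m m).-integrable setT (fun z => g (z.2, z.1)).
Proof.
move=> /integrableP[mg goo]; apply/integrableP; split.
  by apply: (measurableT_comp mg); exact: measurable_swapT.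
rewrite (@ge0_integral_swap (fun z => `|g z|))//.
exact: measurableT_comp.
Qed.

(** Symmetrization of a double integral: the pairs outside [E] are relabelled
by exchanging their two components, which preserves [m \x m] and the square
[C `*` C]. With [E] a half of the square, the right-hand integrand collects both
orderings of a pair. *)
Lemma Rintegral_fold C E (g : T * T -> R) :
  measurable C -> measurable E ->
  (sigma_prod m m).-integrable (C `*` C) (EFin \o g) ->
  (\int[sigma_prod m m]_(z in C `*` C) g z =
   \int[sigma_prod m m]_(z in C `*` C)
     ((g \_ E) z + (g \_ (~` E)) (z.2, z.1)))%R.
Proof.
move=> mC mE; pose gC := (g \_ (C `*` C))%R.
have mCC : measurable (C `*` C) by exact: measurableX.
move=> /(integrable_mkcond _ mCC); rewrite restrict_EFin -/gC => ig.
have ipart X : measurable X ->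
    (sigma_prod m m).-integrable setT (EFin \o (gC \_ X)%R).
  move=> mX; rewrite -restrict_EFin; apply/(integrable_mkcond _ mX).
  exact: integrableS ig.
have iE := ipart _ mE; have iEC := ipart _ (measurableC mE).
transitivity (\int[sigma_prod m m]_z ((gC \_ E) z + (gC \_ (~` E)) z))%R.
  rewrite Rintegral_mkcond; apply: eq_Rintegral => z _.
  rewrite -/gC !patchE in_setC.
  by case: (z \in E); rewrite /= ?addr0 ?add0r.
rewrite [RHS]Rintegral_mkcond.
transitivity
  (\int[sigma_prod m m]_z ((gC \_ E) z + (gC \_ (~` E)) (z.2, z.1)))%R.
  rewrite !RintegralD//; last exact: (integrable_swap iEC).
  congr +%R; congr fine.
  by rewrite -(integral_swap (measurable_int _ iEC)).
apply: eq_Rintegral => -[x y] _; rewrite /gC !patchE !in_setX/= andbC.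
by case: (_ && _); case: ifP; case: ifP; rewrite /= ?addr0 ?add0r.
Qed.

End swap.

(** A probability has total mass one, so averaging over the variable that [g]
ignores gives back [g], and [`|g|] likewise. *)
Lemma integrable_indep d1 d2 (T1 : measurableType d1)
    (T2 : measurableType d2) (R : realType) (P : probability T1 R)
    (m : {sigma_finite_measure set T2 -> \bar R}) (A : set T2) (g : T2 -> \bar R) :
  measurable A ->
  (P \x m)%E.-integrable (setT `*` A) (fun z => g z.2) -> m.-integrable A g.
Proof.
move=> mA; have mTA : measurable (([set: T1] : set T1) `*` A).
  exact: measurableX.
move=> /(integrable_mkcond _ mTA) ig; have mg := measurable_int _ ig.
(* Used with [h] the identity for measurability and with [h] the absolute
   value for finiteness. *)
have avg (h : \bar R -> \bar R) y :
    (\int[P]_x h (((fun z => g z.2) \_ (setT `*` A)) (x, y)) =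
     h ((g \_ A) y))%E.
  rewrite (eq_integral (cst (h ((g \_ A) y)))) => [|x _].
    by rewrite integral_cst//= probability_setT mule1.
  by rewrite /= !patchE in_setX in_setT.
apply/(integrable_mkcond _ mA)/integrableP; split.
  have := measurable_fubini_G ig.
  by congr measurable_fun; apply/funext => y; exact: (avg id).
apply: le_lt_trans ((integrable21ltyP P m mg).1 ig).
by rewrite [leRHS](eq_integral (abse \o (g \_ A)))// => y _; exact: (avg abse).
Qed.

Section noiseless_interaction.
Context {R : realType} {d : nat}.
Variables (F : 'rV[R]_d -> R) (lambda mu : R).
Variable sigma : 'rV[R]_d -> 'rV[R]_d -> R -> R -> R.
Hypothesis sigma0 : forall x xs T Ts, sigma x xs T Ts = 0.

Let post := interaction F lambda mu sigma.

Lemma chi_le0 x xs (T Ts : R) : T <= Ts -> chi F x xs T Ts = 0.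
Proof. by rewrite /chi leNgt => /negbTE ->; rewrite mulr0. Qed.

Lemma chi_idem x xs (T Ts : R) : chi F x xs T Ts ^+ 2 = chi F x xs T Ts.
Proof. by rewrite /chi -natrM mulnb -natrX; case: (_ && _). Qed.

Lemma post_hot x xs (T Ts z zs : R) : Ts <= T ->
  (post x xs T Ts z zs).1 = T - lambda * (T - Ts) * chi F x xs T Ts.
Proof.
by move=> /(chi_le0 xs x) h; rewrite /= h mulr0 subr0 sigma0 mul0r addr0.
Qed.

Lemma post_cold x xs (T Ts z zs : R) : T <= Ts ->
  (post x xs T Ts z zs).1 = T - mu * (T - Ts) * chi F xs x Ts T.
Proof.
by move=> /(chi_le0 x xs) h; rewrite /= h mulr0 subr0 sigma0 mul0r addr0.
Qed.

(** Writing [c] for [chi F x xs T Ts], the two changes are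
[- 2 lambda T (T - Ts) c + lambda^2 (T - Ts)^2 c] and
[2 mu Ts (T - Ts) c + mu^2 (T - Ts)^2 c], because [c^2 = c]; the stated form
follows from [2 T (T - Ts) = (T^2 - Ts^2) + (T - Ts)^2] and
[2 Ts (T - Ts) = (T^2 - Ts^2) - (T - Ts)^2]. *)
Lemma post_sqr_balance x xs (T Ts z zs z' zs' : R) : Ts <= T ->
  ((post x xs T Ts z zs).1 ^+ 2 - T ^+ 2)
    + ((post xs x Ts T z' zs').1 ^+ 2 - Ts ^+ 2) =
  ((mu - lambda) * (T ^+ 2 - Ts ^+ 2)
    + (lambda ^+ 2 + mu ^+ 2 - lambda - mu) * (T - Ts) ^+ 2) * chi F x xs T Ts.
Proof.
move=> TsT; rewrite post_hot// post_cold//.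
by have := chi_idem x xs T Ts; move: (chi _ _ _ _ _) => c cc; ring: cc.
Qed.

End noiseless_interaction.

Lemma weak_L_temperature (R : realType) d (D : set 'rV[R]_d) F eta p f t
    (phi : R -> R) : weak_L D F eta p f t (fun _ => phi) = 0.
Proof.
rewrite /weak_L (@eq_Rintegral _ _ _ _ _ (cst 0)) => [|w _].
  by rewrite /Rintegral integral0.
rewrite (@eq_Rintegral _ _ _ _ _ (cst 0)) => [|xi _].
  by rewrite /Rintegral integral0.
by rewrite /L_integrand subrr mulr0 mul0r mulr0.
Qed.

Lemma measurable_Omega (R : realType) d (D : set 'rV[R]_d) :
  measurable D -> measurable (Omega D).
Proof.
move=> mD; rewrite (_ : Omega D = D `*` `]0, +oo[%classic).
  exact: measurableX.
by apply/seteqP; split=> -[x T] [/= Dx T0]; split; rewrite //= in_itv/= ?andbT// in T0 *.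
Qed.

Theorem lemma3p2 (R : realType) (d : nat) (hd : (0 < d)%N)
  (D : set 'rV[R]_d) (mD : measurable D)
  (F : 'rV[R]_d -> R) (cF : {within D, continuous F})
  (lambda mu : R) (hlambda : 0 <= lambda <= 1) (hmu : 0 <= mu <= 1)
  (hmulambda : mu <= lambda)
  (sigma : 'rV[R]_d -> 'rV[R]_d -> R -> R -> R)
  (hsigma : forall x xs T Ts, sigma x xs T Ts = 0)
  (dW : measure_display) (W : measurableType dW) (P : probability W R)
  (zeta zetas : {RV P >-> R})
  (hzeta : symmetric_centered zeta) (hzetas : symmetric_centered zetas)
  (eta : R -> R) (p : 'rV[R]_d -> R -> R) (hp : symmetric_density p)
  (Phi : set ('rV[R]_d -> R -> R)) (f : 'rV[R]_d -> R -> R -> R)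
  (hf : kinetic_solution D F lambda mu sigma zeta zetas eta p Phi f)
  (hPhi : Phi (fun x T => T ^+ 2)) (t : R) (ht : 0 < t) :
  let M2 := fun s : R => \int[vol]_(w in Omega D) (f w.1 w.2 s * w.2 ^+ 2) in
  is_derive t 1 M2
    (\int[vol2]_(q in Omega D `*` Omega D)
       let: ((x, T), (xs, Ts)) := q in
       (((mu - lambda) * (T ^+ 2 - Ts ^+ 2)
         + (lambda ^+ 2 + mu ^+ 2 - lambda - mu) * (T - Ts) ^+ 2)
        * chi F x xs T Ts * f x T t * f xs Ts t)).
Proof.
cbv zeta.
have [_ /(_ _ hPhi)[[_ _ iQ] dM2]] := hf t ht.
set A := (Omega D `*` Omega D) in iQ *.
have mO := measurable_Omega mD.
have mA : measurable A by exact: measurableX.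
have [w0 _] : [set: W] !=set0.
  apply/set0P/eqP => W0; have := probability_setT P.
  by rewrite W0 measure0 => -[/esym/eqP]; rewrite oner_eq0.
(* Without noise the integrand is the same at every point [w0] of the noise
   space. *)
pose G q := Q_integrand F lambda mu sigma zeta zetas f t (fun _ T => T ^+ 2)
  w0 q.1 q.2.
have GE a q : Q_integrand F lambda mu sigma zeta zetas f t (fun _ T => T ^+ 2)
    a q.1 q.2 = G q.
  by rewrite /G /Q_integrand/= !hsigma !mul0r.
have iG : vol2.-integrable A (EFin \o G).
  apply: (integrable_indep (P := P) mA).
  by apply: eq_integrable iQ => [|q _]; [exact: measurableX|rewrite /= GE].
have QE : weak_Q D F lambda mu sigma zeta zetas f t (fun _ T => T ^+ 2) =
    \int[vol2]_(q in A) G q.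
  rewrite /weak_Q (_ : (fun a : W => _) = cst (\int[vol2]_(q in A) G q)).
    by rewrite expectation_cst.
  by apply/funext => a; apply: eq_Rintegral => q _; exact: GE.
rewrite weak_L_temperature add0r QE in dM2.
pose E := [set q : ('rV[R]_d * measurableTypeR R) *
                  ('rV[R]_d * measurableTypeR R) | q.2.2 < q.1.2].
have mE : measurable E.
  rewrite -[E]setTI.
  apply: (@measurable_fun_ltr _ _ _ setT _ _ _ _ measurableT [set true] I).
    exact: measurableT_comp measurable_snd measurable_snd.
  exact: measurableT_comp measurable_snd measurable_fst.
apply: is_derive_eq dM2 _.
rewrite [LHS](Rintegral_fold mO mE iG).
apply: eq_Rintegral => -[[x T] [xs Ts]] _; move: T Ts => /= T Ts.
have memE y ys (U V : R) : (((y, U), (ys, V)) \in E) = (V < U).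
  exact: asboolb.
rewrite !patchE in_setC !memE -leNgt.
have [TTs|TsT|TTs] := ltgtP T Ts.
- by rewrite chi_le0 ?ltW// mulr0 !mul0r addr0.
- rewrite -(post_sqr_balance F lambda mu hsigma x xs (zeta w0) (zetas w0)
    (zeta w0) (zetas w0) (ltW TsT)).
  by rewrite 2!mulrDl /G /Q_integrand [X in _ + X]mulrAC.
- (* At equal temperatures the relabelled pair lies outside [E] and contributes
     its own, zero, change. *)
  rewrite /G /Q_integrand (post_hot F lambda mu hsigma) ?TTs// !chi_le0//=.
  by rewrite !mulr0 subr0 subrr !mul0r addr0.
Qed.
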